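(* Let $m\ge1$ be an integer and let $p=e^{-X}$ where $X$ has the gamma distribution with shape $m+1$ and rate $1$ (equivalently $p$ has density $\pi(p)=(-\log p)^m/m!$ on $(0,1)$). Conditionally on $p$, let $X_1,X_2,\dots$ be i.i.d. with $P(X_i=j\mid p)=p(1-p)^{j-1}$, $j=1,2,\dots$, let $K_n$ be the number of distinct values among $X_1,\dots,X_n$, and define $$\overrightarrow\nu(x)=\int_0^1\#\{j\ge1:\ p(1-p)^{j-1}\ge x\}\,\pi(p)\,dp,\qquad x\in(0,1).$$ Then $$\overrightarrow\nu(x)=\frac{(\log 1/x)^{m+2}}{(m+2)!}+O\big((\log x)^m\big),\qquad x\to0,$$ and $$\mathrm{E}(K_n)=\frac{(\log n)^{m+2}}{(m+2)!}+\gamma\frac{(\log n)^{m+1}}{(m+1)!}+o\big((\log n)^{m+1}\big),\qquad n\to\infty,$$ where $\gamma$ is the Euler–Mascheroni constant.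
   Context: $\mathrm{E}(K_n)$ is the unconditional expectation (averaging over $p$ and the draws). *)

(* Defs.v *)
From HB Require Import structures.
From mathcomp Require Import all_boot all_order all_algebra.
From mathcomp Require Import all_classical all_reals all_analysis.
Set Implicit Arguments. Unset Strict Implicit. Unset Printing Implicit Defensive.
Import Order.TTheory GRing.Theory Num.Theory.
Local Open Scope classical_set_scope.
Local Open Scope ring_scope.

Section Defs.
Variable R : realType.

(* Mixing density of p = exp(-X), X ~ Gamma(m+1,1): pi(p) = (-log p)^m / m! on (0,1). *)
Definition mixdens (m : nat) (p : R) : R := (- ln p) ^+ m / (m`!)%:R.

Definition geom_pmf (p : R) (j : nat) : R := p * (1 - p) ^+ j.-1.

Definition count_ge (p x : R) : \bar R :=
  (\esum_(j in [set j : nat | (0 < j)%N /\ (x <= geom_pmf p j)%R]) 1)%E.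

Definition nu_arrow (m : nat) (x : R) : \bar R :=
  (\int[lebesgue_measure]_(p in `]0%R, 1%R[%classic)
      (count_ge p x * (mixdens m p)%:E))%E.

Definition ndistinct (n : nat) (x : {ffun 'I_n -> nat}) : nat :=
  size (undup [seq x i | i <- enum 'I_n]).

(* E(K_n | p): expectation of the number of distinct values among n i.i.d.
   draws from geom_pmf p, computed against their joint (product) pmf on
   {1,2,...}^n. *)
Definition EKn_cond (n : nat) (p : R) : \bar R :=
  (\esum_(x in [set x : {ffun 'I_n -> nat} | forall i, (0 < x i)%N])
      ((\prod_(i < n) geom_pmf p (x i)) * (ndistinct x)%:R)%:E)%E.

Definition EKn (m n : nat) : \bar R :=
  (\int[lebesgue_measure]_(p in `]0%R, 1%R[%classic)
      (EKn_cond n p * (mixdens m p)%:E))%E.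

Definition euler_gamma : R :=
  lim ((fun n : nat => \sum_(1 <= k < n.+1) (k%:R)^-1 - ln (n%:R : R)) @ \oo).

End Defs.

(* Main.v *)
Require Import Defs.
From HB Require Import structures.
From mathcomp Require Import all_boot all_order all_algebra.
From mathcomp Require Import all_classical all_reals all_analysis measurable_realfun.
From mathcomp Require Import ring lra zify.
Set Implicit Arguments. Unset Strict Implicit. Unset Printing Implicit Defensive.
Import Order.TTheory GRing.Theory Num.Theory.
Import numFieldNormedType.Exports.
Local Open Scope classical_set_scope.
Local Open Scope ring_scope.

(* Conditionally on [p], [E(K_n | p) = sum_(k >= 0) f (p q^k)] with [q = 1 - p] and
   [f x = 1 - (1 - x)^n]. The polynomial [G] with [G' = f x / x] and [G 0 = 0] is concave,
   so each [G (p q^k) - G (p q^(k+1))] is squeezed between [p f (p q^k)] and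
   [(p / q) f (p q^(k+1))]; telescoping gives [(1 - p) G p / p <= E(K_n | p) <= G p / p].
   Integrating [G p / p] against the density of [p] gives exactly the complete homogeneous
   symmetric polynomial [h_(m+2)] in [1, 1/2, ..., 1/n], which is
   [H_n^(m+2) / (m+2)! + O(H_n^m)] for the harmonic number [H_n = ln n + gamma + o(1)],
   and the correction is [O(H_n)].

   For [nu], the number of [j] with [p q^(j-1) >= x] lies between
   [ln (p / x) (1 / p - 1)] and [ln (p / x) / p + 1] when [p >= x], and
   [ln (p / x) / p] integrates over [x, 1] to exactly [(ln 1/x)^(m+2) / (m+2)!]. *)

(** * Logarithmic moments of polynomials and nested harmonic sums *)

Section harmonic_sums.
Variable R : realFieldType.
Implicit Types (P Q : {poly R}) (n k r : nat).

(* For [r > 0] this is the integral over ]0, 1[ of [P p * (- ln p)^(r-1) / (r-1)!]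
   (see [integral_poly_mixdens]). *)
Definition logmoment r P : R := \sum_(i < size P) P`_i / i.+1%:R ^+ r.

Lemma logmoment_widen r P n : (size P <= n)%N ->
  logmoment r P = \sum_(i < n) P`_i / i.+1%:R ^+ r.
Proof.
move=> Pn; rewrite /logmoment (big_ord_widen n (fun i => P`_i / i.+1%:R ^+ r))//.
rewrite big_mkcond/=; apply: eq_bigr => i _; case: ltnP => // sPi.
by rewrite nth_default// mul0r.
Qed.

Lemma logmomentD r P Q : logmoment r (P + Q) = logmoment r P + logmoment r Q.
Proof.
set n := maxn (size P) (size Q).
rewrite (@logmoment_widen _ (P + Q) n) ?size_polyD//.
rewrite (@logmoment_widen _ P n) ?leq_maxl// (@logmoment_widen _ Q n) ?leq_maxr//.
by rewrite -big_split; apply: eq_bigr => i _; rewrite coefD mulrDl.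
Qed.

Lemma logmomentZ r a P : logmoment r (a *: P) = a * logmoment r P.
Proof.
rewrite (@logmoment_widen _ (a *: P) (size P)) ?size_scale_leq//.
by rewrite mulr_sumr; apply: eq_bigr => i _; rewrite coefZ mulrA.
Qed.

Lemma logmoment0 r : logmoment r 0 = 0.
Proof. by rewrite /logmoment size_poly0 big_ord0. Qed.

Lemma logmoment1 r : logmoment r 1 = 1.
Proof. by rewrite /logmoment size_poly1 big_ord1 coef1 expr1n divr1. Qed.

Lemma logmoment_sum r (I : Type) (s : seq I) (F : I -> {poly R}) :
  logmoment r (\sum_(i <- s) F i) = \sum_(i <- s) logmoment r (F i).
Proof. exact: (big_morph _ (logmomentD r) (logmoment0 r)). Qed.

Lemma logmoment_horner1 P : logmoment 0 P = P.[1].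
Proof.
by rewrite horner_coef; apply: eq_bigr => i _; rewrite expr0 divr1 expr1n mulr1.
Qed.

(* Integration by parts: [P * (-ln)^r / r!] is, up to sign, the product of [P * 'X]
   with the derivative of [(-ln)^(r+1) / (r+1)!]. *)
Lemma logmoment_deriv r P : logmoment r.+1 (P * 'X)^`() = logmoment r P.
Proof.
rewrite (@logmoment_widen _ _ (size P)); last first.
  have [->|P0] := eqVneq P 0; first by rewrite mul0r deriv0.
  by rewrite (leq_trans (size_poly _ _))// size_mulX.
apply: eq_bigr => i _; rewrite coef_deriv coefMX/= -[_ *+ i.+1]mulr_natr exprS.
by rewrite invfM mulrA mulfK ?pnatr_eq0.
Qed.

(** The quotient of [1 - (1 - 'X)^n] by ['X], written as a geometric sum so that it is a
    polynomial. *)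
Definition geomp n : {poly R} := \sum_(i < n) (1 - 'X) ^+ i.

Lemma geompX n : geomp n * 'X = 1 - (1 - 'X) ^+ n.
Proof.
have := subrXX (1 : {poly R}) (1 - 'X) n; rewrite expr1n subKr => ->.
rewrite mulrC; congr (_ * _).
by apply: eq_bigr => i _; rewrite expr1n mul1r.
Qed.

(* The complete homogeneous symmetric polynomial of degree [r] in [1, 1/2, ..., 1/n],
   for [n > 0]. *)
Definition nested_harmonic r n : R := logmoment r (geomp n).

(** One integration by parts: [geomp n.+1 * 'X] has derivative [(n+1) (1 - 'X)^n]. *)
Lemma logmoment_onemX r n :
  logmoment r.+1 ((1 - 'X) ^+ n) = nested_harmonic r n.+1 / n.+1%:R.
Proof.
rewrite /nested_harmonic -(logmoment_deriv r (geomp n.+1)) geompX derivB derivC sub0r deriv_exp/=.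
rewrite derivB derivC derivX sub0r mulN1r mulNrn opprK -scaler_nat logmomentZ.
by rewrite mulrC mulKf// pnatr_eq0.
Qed.

Lemma nested_harmonic0 n : nested_harmonic 0 n.+1 = 1.
Proof.
rewrite /nested_harmonic logmoment_horner1 /geomp horner_sum big_ord_recl/=.
rewrite expr0 hornerC big1 ?addr0// => i _.
by rewrite horner_exp !hornerE subrr expr0n.
Qed.

(** The recursion of complete homogeneous polynomials, with monomials sorted by their largest
    denominator. *)
Lemma nested_harmonicS r n :
  nested_harmonic r.+1 n = \sum_(k < n) nested_harmonic r k.+1 / k.+1%:R.
Proof.
rewrite /nested_harmonic /geomp logmoment_sum; apply: eq_bigr => k _.
exact: logmoment_onemX.
Qed.

Lemma nested_harmonic_ge0 r n : 0 <= nested_harmonic r n.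
Proof.
elim: r n => [|r IHr] [|n].
- by rewrite /nested_harmonic /geomp big_ord0 logmoment0.
- by rewrite nested_harmonic0.
- by rewrite nested_harmonicS big_ord0.
- by rewrite nested_harmonicS sumr_ge0// => k _; rewrite divr_ge0.
Qed.

Definition harmonic_number n : R := \sum_(k < n) k.+1%:R^-1.

Lemma harmonic_numberS n :
  harmonic_number n.+1 = harmonic_number n + n.+1%:R^-1.
Proof. by rewrite /harmonic_number big_ord_recr. Qed.

Lemma harmonic_number_ge0 n : 0 <= harmonic_number n.
Proof. by rewrite sumr_ge0. Qed.

Lemma le_harmonic_number : {homo harmonic_number : m n / (m <= n)%N >-> m <= n}.
Proof.
apply: homo_leq => [//|x y z|n]; first exact: le_trans.
by rewrite harmonic_numberS lerDl.
Qed.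

Lemma nested_harmonic1 n : nested_harmonic 1 n = harmonic_number n.
Proof.
rewrite nested_harmonicS; apply: eq_bigr => k _.
by rewrite nested_harmonic0 div1r.
Qed.

Lemma sum_sqrV_le2 n : \sum_(k < n) (k.+1%:R ^+ 2)^-1 <= 2 :> R.
Proof.
(* The sharper bound [2 - 1 / (n+1)] is what the induction can carry. *)
suff: \sum_(k < n.+1) (k.+1%:R ^+ 2)^-1 <= 2 - n.+1%:R^-1 :> R.
  rewrite big_ord_recr/= => le2; rewrite -[leLHS]addr0.
  apply: le_trans (lerD (lexx _) _) (le_trans le2 _); last by rewrite gerBl.
  by rewrite invr_ge0 exprn_ge0.
elim: n => [|n IHn]; first by rewrite big_ord1 expr1n invr1; lra.
rewrite big_ord_recr/=; apply: le_trans (lerD IHn (lexx _)) _.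
rewrite -addrA lerD2l lerNr opprD opprK.
have n0 : (0 : R) < n.+1%:R by [].
have -> : (n.+2%:R : R) = n.+1%:R + 1 by rewrite -natr1.
move: (n.+1%:R : R) n0 => x x0.
have x10 : 0 < x + 1 by lra.
have -> : x^-1 - ((x + 1) ^+ 2)^-1 = (x + 1)^-1 + (x * (x + 1) ^+ 2)^-1.
  by field; rewrite !gt_eqF.
by rewrite lerDl invr_ge0 mulr_ge0 ?exprn_ge0 ?ltW.
Qed.

(** First-order Taylor remainder at [y] of the power [r+2]. Passing from [r] to [r+1] multiplies it
    by [x] and adds [(r+2) y^(r+1) (y - x)^2]; the crude constant [(r+2)^2] absorbs this. *)
Lemma expr_sub_taylor r (x y : R) : 0 <= x <= y ->
  0 <= r.+2%:R * y ^+ r.+1 * (y - x) - (y ^+ r.+2 - x ^+ r.+2)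
    <= (r.+2 ^ 2)%:R * y ^+ r * (y - x) ^+ 2.
Proof.
move=> /andP[x0 xy]; have y0 := le_trans x0 xy.
elim: r => [|r /andP[IH0 IH]].
  have -> : 2 * y ^+ 1 * (y - x) - (y ^+ 2 - x ^+ 2) = (y - x) ^+ 2 by ring.
  by rewrite sqr_ge0 expr0 mulr1 ler_peMl ?sqr_ge0// ler1n.
set D := _ - _ in IH0 IH.
have -> : r.+3%:R * y ^+ r.+2 * (y - x) - (y ^+ r.+3 - x ^+ r.+3)
    = x * D + r.+2%:R * y ^+ r.+1 * (y - x) ^+ 2.
  by rewrite /D -(natr1 r.+2) !(exprS _ r.+2) !(exprS _ r.+1); ring.
have d0 : 0 <= y ^+ r.+1 * (y - x) ^+ 2 by rewrite mulr_ge0 ?exprn_ge0 ?subr_ge0.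
apply/andP; split.
  by rewrite addr_ge0 ?(mulr_ge0 x0)// -mulrA mulr_ge0.
have xD : x * D <= (r.+2 ^ 2)%:R * y ^+ r.+1 * (y - x) ^+ 2.
  apply: le_trans (ler_pM x0 IH0 xy IH) _.
  by rewrite (exprS y r) !mulrA [y * _]mulrC.
apply: le_trans (lerD xD (lexx _)) _.
rewrite -!mulrA -mulrDl ler_wpM2r// -natrD ler_nat.
by rewrite !expnS !expn0 !muln1; lia.
Qed.

(** Discrete form of integrating [H^(r+1)] against [dH]: each summand is the increment of
    [H^(r+2) / (r+2)] up to a Taylor error quadratic in the step [1 / (k+1)], and the squared steps
    sum to at most [2]. *)
Lemma harmonic_number_pow_sum r n :
  `|\sum_(k < n) harmonic_number k.+1 ^+ r.+1 / k.+1%:R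
     - harmonic_number n ^+ r.+2 / r.+2%:R|
  <= 2 * r.+2%:R * harmonic_number n ^+ r.
Proof.
pose H := harmonic_number.
pose e k := r.+2%:R * (H k.+1 ^+ r.+1 / k.+1%:R) - (H k.+1 ^+ r.+2 - H k ^+ r.+2).
have e_bnd k : 0 <= e k <= (r.+2 ^ 2)%:R * H k.+1 ^+ r * (k.+1%:R ^+ 2)^-1.
  have := @expr_sub_taylor r (H k) (H k.+1).
  rewrite /e /H harmonic_number_ge0 le_harmonic_number// => /(_ isT).
  by rewrite [X in X - harmonic_number k]harmonic_numberS [_ - harmonic_number k]addrC addKr exprVn mulrA.
have eE : r.+2%:R * (\sum_(k < n) H k.+1 ^+ r.+1 / k.+1%:R
     - H n ^+ r.+2 / r.+2%:R) = \sum_(k < n) e k.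
  rewrite mulrBr mulrCA divff ?pnatr_eq0// mulr1 mulr_sumr /e sumrB; congr (_ - _).
  rewrite -(big_mkord xpredT (fun k => H k.+1 ^+ r.+2 - H k ^+ r.+2)).
  by rewrite telescope_sumr// /H /harmonic_number big_ord0 expr0n subr0.
rewrite -(@ler_pM2l _ r.+2%:R)// -[X in X * `|_|]ger0_norm// -normrM eE ger0_norm; last first.
  by rewrite sumr_ge0// => k _; have /andP[] := e_bnd k.
apply: (@le_trans _ _ (\sum_(k < n) (r.+2 ^ 2)%:R * H n ^+ r * (k.+1%:R ^+ 2)^-1)).
  apply: ler_sum => k _; have /andP[_ /le_trans->//] := e_bnd k.
  rewrite ler_wpM2r ?invr_ge0 ?exprn_ge0// ler_wpM2l//.
  by rewrite lerXn2r ?nnegrE ?harmonic_number_ge0 ?le_harmonic_number.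
rewrite -mulr_sumr natrX.
have -> : r.+2%:R * (2 * r.+2%:R * harmonic_number n ^+ r) = r.+2%:R ^+ 2 * H n ^+ r * 2.
  by rewrite /H; ring.
by rewrite ler_wpM2l ?sum_sqrV_le2// mulr_ge0 ?exprn_ge0 ?harmonic_number_ge0.
Qed.

(** Induction along [nested_harmonicS]: the earlier error sums to at most [C H^(r+1)], since [H] is
    monotone and the weights sum to [H]; the main term is summed by [harmonic_number_pow_sum]. *)
Lemma nested_harmonic_asymp r : exists2 C : R, 0 <= C & forall n,
  `|nested_harmonic r.+2 n - harmonic_number n ^+ r.+2 / r.+2`!%:R|
  <= C * harmonic_number n ^+ r.
Proof.
pose H := harmonic_number.
elim: r => [|r [C C0 IH]].
  exists 4 => // n; have := harmonic_number_pow_sum 0 n.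
  rewrite nested_harmonicS expr0 !mulr1 -natrM.
  by under eq_bigr do rewrite expr1 -nested_harmonic1.
exists (C + 2 * r.+3%:R); first by rewrite addr_ge0// mulr_ge0.
move=> n; rewrite nested_harmonicS.
have -> : \sum_(k < n) nested_harmonic r.+2 k.+1 / k.+1%:R
    - harmonic_number n ^+ r.+3 / (r.+3)`!%:R =
  \sum_(k < n) (nested_harmonic r.+2 k.+1 - H k.+1 ^+ r.+2 / (r.+2)`!%:R) / k.+1%:R
  + (r.+2)`!%:R^-1 * (\sum_(k < n) H k.+1 ^+ r.+2 / k.+1%:R
     - H n ^+ r.+3 / r.+3%:R).
  rewrite mulrBr addrA; congr (_ - _); last first.
    by rewrite mulrCA -invfM -natrM mulnC -factS.
  rewrite mulr_sumr -big_split; apply: eq_bigr => k _/=.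
  by rewrite mulrBl mulrA [_^-1 * _]mulrC subrK.
rewrite mulrDl; apply: le_trans (ler_normD _ _) (lerD _ _).
  apply: le_trans (ler_norm_sum _ _ _) _.
  rewrite exprSr mulrA [X in _ <= _ * X]/harmonic_number mulr_sumr.
  apply: ler_sum => k _; rewrite normrM [`|_^-1|]ger0_norm// ler_wpM2r//.
  apply: le_trans (IH _) _; rewrite ler_wpM2l//.
  by rewrite lerXn2r ?nnegrE ?harmonic_number_ge0 ?le_harmonic_number.
rewrite normrM ger0_norm ?invr_ge0//.
apply: le_trans (harmonic_number_pow_sum r.+1 n).
by rewrite ler_piMl// invf_le1 ?ler1n ?ltr0n ?fact_gt0.
Qed.

End harmonic_sums.

(** * Sums over countable and product index sets *)

Section esum_extra.
Variable R : realType.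
Local Open Scope ereal_scope.

(** One inequality holds for every nonnegative factor; for [c > 0], applying it to [c^-1] and [c f]
    gives the other. *)
Lemma esumZl (T : choiceType) (I : set T) (c : R) (f : T -> \bar R) :
  (0 <= c)%R -> (forall i, 0 <= f i) ->
  \esum_(i in I) (c%:E * f i) = c%:E * \esum_(i in I) f i.
Proof.
have le_esumZ (e : R) (g : T -> \bar R) : (0 <= e)%R -> (forall i, 0 <= g i) ->
    \esum_(i in I) (e%:E * g i) <= e%:E * \esum_(i in I) g i.
  move=> e0 g0; apply: ge_ereal_sup => _ [X XI <-].
  rewrite -ge0_mule_fsumr// lee_wpmul2l ?lee_fin//.
  by apply: ereal_sup_ubound; exists X.
move=> + f0; rewrite le_eqVlt => /predU1P[<-|c0].
  by rewrite mul0e esum1// => i _; rewrite mul0e.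
apply/eqP; rewrite eq_le le_esumZ ?(ltW c0)//=.
have := @le_esumZ c^-1%R (fun i => c%:E * f i).
rewrite invr_ge0 (ltW c0) => /(_ isT) le_f.
rewrite -lee_pdivlMl//; apply: le_trans (le_f _); last first.
  by move=> i; rewrite mule_ge0// lee_fin ltW.
by apply: le_esum => i _; rewrite muleA -EFinM mulVf ?gt_eqF// mul1e.
Qed.

Lemma exchange_esum (T1 T2 : choiceType) (I : set T1) (J : set T2)
    (a : T1 -> T2 -> \bar R) : (forall i j, I i -> J j -> 0 <= a i j) ->
  \esum_(i in I) \esum_(j in J) a i j = \esum_(j in J) \esum_(i in I) a i j.
Proof.
move=> a0; rewrite !esum_esum//; last by move=> j i Jj Ii; exact: a0.
apply: (@reindex_esum _ _ _ _ _ (fun k : T2 * T1 => (k.2, k.1))).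
split.
- by move=> [j i] [/= Jj Ii].
- by move=> [j i] [j' i'] _ _ [-> ->].
- by move=> [i j] [/= Ii Jj]; exists (j, i).
Qed.

(** Takes a pair, so that it can serve as the reindexing map from a product of index sets. *)
Definition ffun_cons (T : Type) n (k : T * {ffun 'I_n -> T}) : {ffun 'I_n.+1 -> T} :=
  [ffun i => if unlift ord0 i is Some h then k.2 h else k.1].

Lemma ffun_cons_bij (T : Type) n (J : set T) :
  set_bij (J `*`` fun=> [set y : {ffun 'I_n -> T} | forall i, J (y i)])
    [set x : {ffun 'I_n.+1 -> T} | forall i, J (x i)] (@ffun_cons T n).
Proof.
split.
- move=> [j y] [/= Jj Jy] i; rewrite ffunE/=.
  by case: unliftP => [h _|_].
- move=> [j y] [j' y'] _ _ /= /ffunP eqjy; congr (_, _).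
    by have := eqjy ord0; rewrite !ffunE unlift_none.
  by apply/ffunP => h; have := eqjy (lift ord0 h); rewrite !ffunE liftK.
- move=> x /= Jx; exists (x ord0, [ffun h => x (lift ord0 h)]).
    by split => //= i; rewrite ffunE.
  apply/ffunP => i; rewrite ffunE/=.
  by case: unliftP => [h ->|->//]; rewrite ffunE.
Qed.

(** Induction on [n], splitting off the first entry. With [J] all positive integers this is the
    total mass of the draws; with [J] those other than [j], it is the probability that [n] draws
    avoid [j]. *)
Lemma esum_ffun_prod (T : choiceType) n (J : set T) (w : T -> R) (s : R) :
  (forall j, (0 <= w j)%R) -> \esum_(j in J) (w j)%:E = s%:E ->
  \esum_(x in [set x : {ffun 'I_n -> T} | forall i, J (x i)])
    (\prod_(i < n) w (x i))%R%:E = (s ^+ n)%:E.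
Proof.
move=> w0 ws; elim: n => [|n IHn].
  have [x0 _] : exists x : {ffun 'I_0 -> T}, True.
    by exists (@ffun0 'I_0 (fun=> T) (card_ord 0)).
  rewrite (_ : [set _ | _] = [set x0]); last first.
    by apply/seteqP; split => x//= _; [apply/ffunP => -[]|move=> []].
  by rewrite esum_set1 big_ord0 ?lee_fin.
have prodw0 m (y : {ffun 'I_m -> T}) : (0 <= \prod_(i < m) w (y i))%R.
  by rewrite prodr_ge0.
rewrite (reindex_esum _ _ _ _ (ffun_cons_bij _ _)).
rewrite (_ : \esum_(_ in _) _ =
    \esum_(k in J `*`` fun=> [set y : {ffun 'I_n -> T} | forall i, J (y i)])
      ((w k.1)%:E * (\prod_(i < n) w (k.2 i))%R%:E)); last first.
  apply: eq_esum => -[j y] _ /=; rewrite -EFinM big_ord_recl; congr ((_ * _)%:E).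
    by rewrite ffunE unlift_none.
  by apply: eq_bigr => i _; rewrite ffunE liftK.
rewrite -(@esum_esum _ _ _ J (fun=> [set y : {ffun 'I_n -> T} | forall i, J (y i)])
  (fun j y => (w j)%:E * (\prod_(i < n) w (y i))%R%:E)); last first.
  by move=> j y _ _; rewrite -EFinM lee_fin mulr_ge0 ?w0 ?prodw0.
transitivity (\esum_(j in J) ((s ^+ n)%:E * (w j)%:E)).
  apply: eq_esum => j _; rewrite esumZl; [|exact: w0|]; last first.
    by move=> y; rewrite lee_fin; exact: prodw0.
  by rewrite IHn [RHS]muleC.
have s0 : (0 <= s)%R by rewrite -lee_fin -ws esum_ge0// => j _; rewrite lee_fin.
rewrite esumZl ?ws; [|exact: exprn_ge0|by move=> j; rewrite lee_fin; exact: w0].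
by rewrite -EFinM exprSr.
Qed.

End esum_extra.

(** * The conditional expectation given [p] as a series *)

Section conditional_expectation.
Variables (R : realType) (p : R).
Hypothesis p01 : 0 < p < 1.
Local Open Scope ereal_scope.

Let p_gt0 : (0 < p)%R. Proof. by case/andP: p01. Qed.
Let p_lt1 : (p < 1)%R. Proof. by case/andP: p01. Qed.
Let q_ge0 : (0 <= 1 - p)%R. Proof. by rewrite subr_ge0 ltW. Qed.
Let p_ge0 : (0 <= p)%R. Proof. exact: ltW. Qed.

Lemma geom_pmf_ge0 j : (0 <= geom_pmf p j)%R.
Proof. by rewrite mulr_ge0 ?exprn_ge0. Qed.

Lemma geom_pmf_le1 j : (geom_pmf p j <= 1)%R.
Proof. by rewrite mulr_ile1 ?exprn_ge0 ?exprn_ile1 ?gerBl// ltW. Qed.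

Lemma succn_bij : set_bij [set: nat] [set j | 0 < j]%N succn.
Proof.
split => [//|i j _ _ []//|[|j] //= _].
by exists j.
Qed.

Lemma sum_geom_pmf : \esum_(j in [set j | (0 < j)%N]) (geom_pmf p j)%:E = 1.
Proof.
rewrite (reindex_esum _ _ _ _ succn_bij) -nneseries_esumT; last first.
  by move=> j; rewrite lee_fin geom_pmf_ge0.
apply/cvg_lim => //=.
rewrite (_ : (fun _ => _) = EFin \o series (geometric p (1 - p))); last first.
  by apply/funext => n /=; rewrite sumEFin.
apply: cvg_EFin; first exact: nearW.
have {2}-> : 1%R = (p / (1 - (1 - p)))%R by rewrite subKr divff ?gt_eqF.
by apply: cvg_geometric_series; rewrite ger0_norm// gtrBl.
Qed.

Lemma sum_geom_pmfD1 j : (0 < j)%N ->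
  \esum_(i in [set i | (0 < i)%N /\ i <> j]) (geom_pmf p i)%:E = (1 - geom_pmf p j)%:E.
Proof.
move=> j0; have := sum_geom_pmf.
rewrite (esumID [set j]); last by move=> i _; rewrite lee_fin geom_pmf_ge0.
rewrite (_ : _ `&` [set j] = [set j]); last first.
  by apply/seteqP; split => [i []//|i/= ->].
rewrite esum_set1 ?lee_fin ?geom_pmf_ge0//.
rewrite (_ : _ `&` ~` [set j] = [set i | (0 < i)%N /\ i <> j])//.
by move=> /(congr1 (fun x => x - (geom_pmf p j)%:E)); rewrite addeAC subee ?add0e.
Qed.

(** Writes the count as a sum of indicators over all possible values, so that its expectation
    becomes a sum of probabilities. *)
Lemma ndistinct_esum n (x : {ffun 'I_n -> nat}) : (forall i, 0 < x i)%N ->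
  (ndistinct x)%:R%:E = \esum_(j in [set j | (0 < j)%N])
    (if j \in [set j | exists i, x i = j] then 1 else 0) :> \bar R.
Proof.
move=> x0; rewrite -esum_mkcondr.
rewrite (_ : _ `&` _ = [set` undup [seq x i | i <- enum 'I_n]]); last first.
  apply/seteqP; split => [j [_ [i <-]]|j]/=; rewrite mem_undup.
    by rewrite map_f ?mem_enum.
  by move=> /mapP[i _ ->]; split; [exact: x0|exists i].
rewrite esum_fset//; last exact: finite_seq.
rewrite -fsbig_seq ?undup_uniq// /ndistinct.
rewrite sumEFin; congr (_%:E); rewrite big_const_seq count_predT.
by rewrite iter_addr_0.
Qed.

(** Linearity of expectation: the value [j = k + 1] occurs with probability one minus that of [n]
    draws avoiding it. *)
Lemma EKn_condE n : EKn_cond n p =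
  \sum_(k <oo) (1 - (1 - p * (1 - p) ^+ k) ^+ n)%:E.
Proof.
pose A := [set x : {ffun 'I_n -> nat} | forall i, (0 < x i)%N].
pose w (x : {ffun 'I_n -> nat}) : R := (\prod_(i < n) geom_pmf p (x i))%R.
have w0 x : (0 <= w x)%R by rewrite prodr_ge0// => i _; exact: geom_pmf_ge0.
have ind0 (b : bool) : 0 <= (if b then 1 else 0) :> \bar R by case: b.
transitivity (\esum_(x in A) \esum_(j in [set j | (0 < j)%N])
    ((w x)%:E * if j \in [set j | exists i, x i = j] then 1 else 0)).
  apply: eq_esum => x Ax; rewrite esumZl; [|exact: w0|by move=> j; exact: ind0].
  by rewrite -ndistinct_esum// -EFinM.
rewrite exchange_esum; last by move=> *; rewrite mule_ge0 ?lee_fin.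
rewrite (reindex_esum _ _ _ _ succn_bij) nneseries_esumT; last first.
  move=> k; rewrite lee_fin subr_ge0 exprn_ile1//.
    by rewrite subr_ge0 (geom_pmf_le1 k.+1).
  by rewrite gerBl (geom_pmf_ge0 k.+1).
apply: eq_esum => k _; rewrite -/(geom_pmf p k.+1); set j := k.+1.
pose B := [set x : {ffun 'I_n -> nat} | forall i, x i <> j].
(* [B] is the event that [j] is never drawn, so the indicator selects the complement of [B]. *)
transitivity (\esum_(x in A `&` ~` B) (w x)%:E).
  rewrite esum_mkcondr; apply: eq_esum => x _.
  case: ifPn => [/set_mem[i xij]|xj0].
    by rewrite mule1 ifT// inE => /(_ i); exact.
  have xj : ~ exists i, x i = j by move: xj0; rewrite notin_setE.
  rewrite mule0 ifF//; apply/negbTE; rewrite notin_setE/= => xNB.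
  by apply: xNB => i xij; apply: xj; exists i.
have AB : \esum_(x in A `&` B) (w x)%:E = ((1 - geom_pmf p j) ^+ n)%:E.
  rewrite -(esum_ffun_prod _ _ (sum_geom_pmfD1 (ltn0Sn k)));
    last exact: geom_pmf_ge0.
  congr (esum _ _); apply/seteqP; split => [x [Ax Bx] i|x xAB].
    by split; [exact: Ax|exact: Bx].
  by split => i; have [] := xAB i.
have : \esum_(x in A) (w x)%:E = 1%R%:E.
  rewrite -(expr1n R n) -(esum_ffun_prod _ _ sum_geom_pmf)//.
  exact: geom_pmf_ge0.
rewrite (esumID B) ?AB; last by move=> x _; rewrite lee_fin.
move=> /(congr1 (fun x => x - ((1 - geom_pmf p j) ^+ n)%:E)).
by rewrite addeAC subee ?add0e.
Qed.

End conditional_expectation.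

(** * Two-sided bounds on the series by concavity and telescoping *)

Section conditional_expectation_bounds.
Variable R : realType.
Implicit Types (p x y : R) (n k : nat).

(** This is [G x / x], where [G] is the primitive of [(1 - (1 - x)^n) / x] that vanishes at [0]. *)
Definition harmonic_geomp n : {poly R} := \sum_(k < n) k.+1%:R^-1 *: geomp R k.+1.

Lemma horner_geomp n x : (geomp R n).[x] = \sum_(i < n) (1 - x) ^+ i.
Proof.
rewrite /geomp horner_sum; apply: eq_bigr => i _.
by rewrite horner_exp !hornerE.
Qed.

Lemma geompM n x : (geomp R n).[x] * x = 1 - (1 - x) ^+ n.
Proof. by rewrite -hornerMX geompX !hornerE. Qed.

Lemma harmonic_geompM n x :
  (harmonic_geomp n).[x] * x = \sum_(k < n) (1 - (1 - x) ^+ k.+1) / k.+1%:R.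
Proof.
rewrite /harmonic_geomp horner_sum mulr_suml; apply: eq_bigr => k _.
by rewrite hornerZ -mulrA geompM mulrC.
Qed.

(** Mean value inequality for [z^(k+1) / (k+1)]: after factoring out [y - x], the [k+1] remaining
    monomials of degree [k] lie between [x^k] and [y^k]. *)
Lemma exprB_bounds k x y : 0 <= x <= y ->
  (y - x) * x ^+ k <= (y ^+ k.+1 - x ^+ k.+1) / k.+1%:R <= (y - x) * y ^+ k.
Proof.
move=> /andP[x0 xy]; have y0 := le_trans x0 xy.
have k0 : (0 : R) < k.+1%:R by [].
have yx : 0 <= y - x by rewrite subr_ge0.
have xXy i : x ^+ i <= y ^+ i by rewrite lerXn2r.
have cst (z : R) : z ^+ k * k.+1%:R = \sum_(i < k.+1) z ^+ (k - i) * z ^+ i.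
  rewrite (eq_bigr (fun=> z ^+ k)); last first.
    by move=> i _; rewrite -exprD subnK// -ltnS ltn_ord.
  by rewrite sumr_const card_ord mulr_natr.
rewrite ler_pdivlMr// ler_pdivrMr// subrXX -!mulrA !cst.
by rewrite !ler_wpM2l//; apply: ler_sum => i _; rewrite ler_pM ?exprn_ge0.
Qed.

(* [u |-> (harmonic_geomp n).[u] * u] has derivative [(geomp R n).[u]], which is
   nonincreasing on [0, 1]. *)
Lemma harmonic_geomp_concave n x y : 0 <= y -> y <= x -> x <= 1 ->
  (x - y) * (geomp R n).[x] <= (harmonic_geomp n).[x] * x - (harmonic_geomp n).[y] * y
    <= (x - y) * (geomp R n).[y].
Proof.
move=> y0 yx x1; rewrite !harmonic_geompM !horner_geomp !mulr_sumr -sumrB.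
have bnd k := @exprB_bounds k (1 - x) (1 - y).
have xyE : 1 - y - (1 - x) = x - y by ring.
have xy01 : 0 <= 1 - x <= 1 - y by rewrite subr_ge0 x1 lerD2l lerN2.
have E k : (1 - (1 - x) ^+ k.+1) / k.+1%:R - (1 - (1 - y) ^+ k.+1) / k.+1%:R =
    ((1 - y) ^+ k.+1 - (1 - x) ^+ k.+1) / k.+1%:R.
  by rewrite -mulrBl; congr (_ / _); ring.
apply/andP; split; apply: ler_sum => k _; rewrite E -xyE;
  by have /andP[] := bnd k xy01.
Qed.

Lemma harmonic_geomp_ge0 n x : 0 <= x <= 1 -> 0 <= (harmonic_geomp n).[x].
Proof.
move=> /andP[x0 x1]; rewrite /harmonic_geomp horner_sum sumr_ge0// => k _.
rewrite hornerZ mulr_ge0// horner_geomp sumr_ge0// => i _.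
by rewrite exprn_ge0// subr_ge0.
Qed.

Lemma EKn_cond_bounds n p : 0 < p < 1 ->
  (((harmonic_geomp n).[p] * (1 - p))%:E <= EKn_cond n p
    <= ((harmonic_geomp n).[p])%:E)%E.
Proof.
move=> p01; rewrite EKn_condE//.
have [p0 p1] : 0 < p /\ p < 1 by case/andP: p01.
pose q := 1 - p.
have q0 : 0 < q by rewrite subr_gt0.
have q1 : q <= 1 by rewrite gerBl ltW.
have [p0' q0'] : 0 <= p /\ 0 <= q by rewrite !ltW.
pose f x := 1 - (1 - x) ^+ n.
pose G x := (harmonic_geomp n).[x] * x.
have pq01 k : 0 <= p * q ^+ k <= 1.
  by rewrite mulr_ge0 ?exprn_ge0//= mulr_ile1 ?exprn_ge0 ?exprn_ile1// ltW.
have f0 k : 0 <= f (p * q ^+ k).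
  have /andP[? ?] := pq01 k.
  by rewrite subr_ge0 exprn_ile1 ?subr_ge0// gerBl.
(* Concavity between [x = p q^k] and [x q], whose distance is [p x]; the factor [x] turns [geomp]
   into [f]. In the second bound multiplying by [q] produces the argument [x q]. *)
have step k : p * f (p * q ^+ k) <= G (p * q ^+ k) - G (p * q ^+ k.+1) /\
    q * (G (p * q ^+ k) - G (p * q ^+ k.+1)) <= p * f (p * q ^+ k.+1).
  have /andP[x0 x1] := pq01 k.
  have xq : p * q ^+ k.+1 = p * q ^+ k * q by rewrite exprSr mulrA.
  rewrite xq; move: (p * q ^+ k) x0 x1 => x x0 x1.
  have := @harmonic_geomp_concave n x (x * q).
  rewrite mulr_ge0// ler_piMr// => /(_ isT isT x1)/andP[].
  have -> : x - x * q = p * x by rewrite /q; ring.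
  rewrite -!/(G _) => lo up; split.
    by apply: le_trans lo; rewrite /f -geompM [X in _ <= X]mulrAC mulrA.
  apply: le_trans (ler_wpM2l q0' up) _.
  by rewrite /f -geompM le_eqVlt; apply/orP; left; apply/eqP; ring.
have sumG N : \sum_(0 <= k < N) (G (p * q ^+ k) - G (p * q ^+ k.+1)) =
    G p - G (p * q ^+ N).
  transitivity (- \sum_(0 <= k < N) (G (p * q ^+ k.+1) - G (p * q ^+ k))).
    by rewrite -sumrN; apply: eq_bigr => k _; rewrite opprB.
  by rewrite telescope_sumr// expr0 mulr1 opprB.
have G0 x : 0 <= x <= 1 -> 0 <= G x.
  by move=> x01; rewrite mulr_ge0 ?harmonic_geomp_ge0//; case/andP: x01.
have up : (\sum_(k <oo) (f (p * q ^+ k))%:E <= ((harmonic_geomp n).[p])%:E)%E.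
  apply: lime_le; first by apply: is_cvg_nneseries => k _ _; rewrite lee_fin.
  apply: nearW => N; rewrite sumEFin lee_fin -(ler_pM2l p0) mulr_sumr.
  apply: (@le_trans _ _ (G p - G (p * q ^+ N))).
    by rewrite -sumG; apply: ler_sum => k _; have [] := step k.
  rewrite [leRHS]mulrC -/(G p) gerBl G0//; exact: pq01.
apply/andP; split => //.
have S0 : (0 <= \sum_(k <oo) (f (p * q ^+ k))%:E)%E.
  by apply: nneseries_ge0 => k _ _; rewrite lee_fin.
have part N : (\sum_(0 <= k < N) (f (p * q ^+ k))%:E <= \sum_(k <oo) (f (p * q ^+ k))%:E)%E.
  by apply: nneseries_lim_ge => k _ _; rewrite lee_fin.
rewrite -/q -/(f _) in S0 up part *.
(* [S0] and [up] exclude infinite values, so the rest is a statement about a real number [S]. *)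
move: (\sum_(k <oo) _)%E S0 up part => [S| |]// S0 up part.
rewrite lee_fin.
have lo N : (harmonic_geomp n).[p] * q - (n%:R * q) * q ^+ N <= S.
  have := part N.+1; rewrite sumEFin lee_fin; apply: le_trans.
  rewrite -(ler_pM2l p0).
  apply: (@le_trans _ _ (q * (G p - G (p * q ^+ N)))).
    (* The slope of [G] at [0] is [n], so concavity bounds the telescoping remainder [G (p q^N)] by
       [n p q^N], which vanishes as [N] grows. *)
    rewrite /G; have /andP[x0 x1] := pq01 N.
    have := @harmonic_geomp_concave n (p * q ^+ N) 0 (lexx _) x0 x1.
    rewrite mulr0 !subr0 => /andP[_].
    have -> : (geomp R n).[0] = n%:R.
      rewrite horner_geomp subr0; under eq_bigr do rewrite expr1n.
      by rewrite sumr_const card_ord.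
    move=> /(ler_wpM2l q0').
    set h := (harmonic_geomp n).[p]; set g := _ * (p * q ^+ N) => le_g.
    have -> : p * (h * q - n%:R * q * q ^+ N) =
        q * (h * p) - q * (p * q ^+ N * n%:R) by ring.
    by rewrite mulrBr lerD2l lerN2.
  (* The second half of [step] evaluates [f] at [p q^(k+1)], so the partial sum of length [N.+1] is
     used and its first term [f p] is dropped. *)
  rewrite -sumG mulr_sumr big_nat_recl//= mulrDr.
  apply: (@le_trans _ _ (p * \sum_(0 <= i < N) f (p * q ^+ i.+1))).
    by rewrite mulr_sumr; apply: ler_sum => k _; have [] := step k.
  by rewrite lerDr mulr_ge0// f0.
have q1' : `|q| < 1 by rewrite ger0_norm// gtrBl.
have cvgq : (harmonic_geomp n).[p] * q - (n%:R * q) * q ^+ N @[N --> \oo]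
    --> (harmonic_geomp n).[p] * q - 0.
  by apply: cvgB; [exact: cvg_cst|exact: (cvg_geometric (n%:R * q) q1')].
rewrite subr0 in cvgq; rewrite -(cvg_lim _ cvgq)//.
apply: limr_le; first by apply/cvg_ex; eexists; exact: cvgq.
by apply: nearW => N; exact: lo.
Qed.

End conditional_expectation_bounds.

(** * Comparison of integrals and the fundamental theorem of calculus *)

Section integral_extra.
Variable R : realType.
Local Notation mu := (@lebesgue_measure R).

(** Argues on the supremum over simple functions, so as to apply to [EKn_cond] and [count_ge], whose
    measurability in [p] is never established. *)
Lemma ge0_le_integral_restrict d (T : measurableType d)
    (nu : {measure set T -> \bar R}) (D E : set T) (f g : T -> \bar R) :
  (forall x, D x -> 0 <= f x)%E -> (forall x, E x -> 0 <= g x)%E ->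
  (forall x, (f \_ D) x <= (g \_ E) x)%E ->
  (\int[nu]_(x in D) f x <= \int[nu]_(x in E) g x)%E.
Proof.
move=> f0 g0 fg; rewrite !ge0_integralE//; apply: le_ereal_sup.
by move=> _ [h hf <-]; exists h => // x; exact: le_trans (hf x) (fg x).
Qed.

Lemma integral_FTC2_pos (f F : R -> R) (a b : R) : 0 < a -> a < b ->
  (forall x : R, 0 < x -> {for x, continuous f}) ->
  (forall x : R, 0 < x -> is_derive x 1 F (f x)) ->
  (\int[mu]_(x in `[a, b]) (f x)%:E = (F b)%:E - (F a)%:E)%E.
Proof.
move=> a0 ab cf dF; have b0 := lt_trans a0 ab.
have cF x : 0 < x -> {for x, continuous F}.
  move=> x0; have := dF x x0 => dFx.
  by apply: differentiable_continuous; apply/derivable1_diffP; exact: ex_derive.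
apply: continuous_FTC2 => //.
- apply: continuous_in_subspaceT => x; rewrite inE/= in_itv/= => /andP[ax _].
  by apply: cf; exact: lt_le_trans ax.
- split.
  + move=> x; rewrite in_itv/= => /andP[ax _].
    by have := dF x (lt_trans a0 ax) => dFx; exact: ex_derive.
  + by apply: cvg_at_right_filter; exact: cF.
  + by apply: cvg_at_left_filter; exact: cF.
- move=> x; rewrite in_itv/= => /andP[ax _].
  by have := dF x (lt_trans a0 ax) => dFx; rewrite derive1E derive_val.
Qed.

End integral_extra.

(** * Integration of polynomials against the mixing density *)

Section mixing_density.
Variable R : realType.
Local Notation mu := (@lebesgue_measure R).
Implicit Types (p x : R) (m n a : nat).

(** The factorial normalisation makes differentiation lower the index without a constant; the
    antiderivatives below rest on this. *)
Lemma is_derive_mixdens m p : 0 < p ->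
  is_derive p 1 (mixdens m.+1) (- (mixdens m p / p)).
Proof.
move=> p0; have dln := is_derive1_ln p0.
have dlnX := is_deriveX m.+1 (is_deriveN dln); rewrite exprfctE in dlnX.
have dmix := is_deriveZ (m.+1)`!%:R^-1 dlnX.
rewrite (_ : mixdens m.+1 = (m.+1)`!%:R^-1 \*: (fun y => (- @ln R) y ^+ m.+1)); last first.
  by apply/funext => y; rewrite /mixdens mulrC.
apply: is_derive_eq; rewrite /mixdens factS natrM invfM /GRing.scale/=.
change ((- @ln R) p) with (- ln p); rewrite mulrN mulrN mulrA; congr (- (_ / _)).
by rewrite mulrC mulrACA divff ?pnatr_eq0// mul1r.
Qed.

Lemma continuous_mixdens m p : 0 < p -> {for p, continuous (@mixdens R m)}.
Proof.
move=> p0; case: m => [|m].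
  rewrite (_ : mixdens 0 = cst 1); first exact: cst_continuous.
  by apply/funext => y; rewrite /mixdens expr0 fact0 divr1.
have := is_derive_mixdens m p0 => dm.
by apply: differentiable_continuous; apply/derivable1_diffP; exact: ex_derive.
Qed.

Lemma mixdens_ge0 m p : p <= 1 -> 0 <= mixdens m p.
Proof. by move=> p1; rewrite divr_ge0// exprn_ge0// oppr_ge0 ln_le0. Qed.

Lemma mixdensS1 m : mixdens m.+1 (1 : R) = 0.
Proof. by rewrite /mixdens ln1 oppr0 expr0n mul0r. Qed.

Lemma mulr_ln_mixdens m p : (- ln p) * mixdens m p = m.+1%:R * mixdens m.+1 p.
Proof.
by rewrite /mixdens exprS factS natrM invfM [RHS]mulrCA mulVKf ?pnatr_eq0// mulrA.
Qed.

(** Antiderivative of [p^a * mixdens m p] from [m] successive integrations by parts; it tends to [0]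
    at [0]. *)
Fixpoint logmoment_antideriv a m p : R :=
  if m is m'.+1
  then (p ^+ a.+1 * mixdens m p + logmoment_antideriv a m' p) / a.+1%:R
  else p ^+ a.+1 / a.+1%:R.

Lemma is_derive_logmoment_antideriv a m p : 0 < p ->
  is_derive p 1 (logmoment_antideriv a m) (p ^+ a * mixdens m p).
Proof.
move=> p0.
have dX : is_derive p 1 (fun p => p ^+ a.+1) (a.+1%:R * p ^+ a).
  have := is_deriveX a.+1 (is_derive_id p (1 : R)); rewrite exprfctE => dX.
  by apply: is_derive_eq; rewrite /GRing.scale/= mulr1.
have a0 : a.+1%:R != 0 :> R by rewrite pnatr_eq0.
have divE (f : R -> R) (df : R) : is_derive p 1 f df ->
    is_derive p 1 (fun p => f p / a.+1%:R) (df / a.+1%:R).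
  move=> df_; have := is_deriveZ a.+1%:R^-1 df_.
  rewrite (_ : _ \*: _ = (fun p => f p / a.+1%:R)); last by apply/funext => y; rewrite mulrC.
  by rewrite /GRing.scale/= mulrC.
elim: m => [|m IHm].
  have := divE _ _ dX => dX'; apply: is_derive_eq.
  by rewrite /mixdens expr0 fact0 divr1 mulr1 mulrC mulKf.
have := is_derive_mixdens m p0 => dm.
have := divE _ _ (is_deriveD (is_deriveM dX dm) IHm) => dF.
apply: is_derive_eq; rewrite /GRing.scale/=.
apply: (mulIf a0); rewrite divfK// exprS.
by field; rewrite gt_eqF.
Qed.

Lemma measurable_mixdens m : measurable_fun [set: R] (@mixdens R m).
Proof.
apply: measurable_funM => //; apply: measurable_funX.
apply: measurableT_comp => //; exact: measurable_ln.
Qed.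

(** [expR t] dominates the term [t^(k+1) / (k+1)!] of its series. With [p = expR (- t)] this
    controls the boundary terms at [p = 0]. *)
Lemma expRN_mixdens_le k (t : R) : 0 < t ->
  expR (- t) * mixdens k (expR (- t)) <= k.+1%:R / t.
Proof.
move=> t0; rewrite /mixdens expRK opprK expRN.
rewrite -ler_pdivlMl ?invr_gt0 ?expR_gt0// invrK.
have := expR_ge1Dxn k (ltW t0) => le_exp.
have -> : t ^+ k / k`!%:R = t ^+ k.+1 / (k.+1)`!%:R * (k.+1%:R / t).
  rewrite factS natrM invfM exprS.
  by field; rewrite ?gt_eqF//= ?pnatr_eq0 -?lt0n ?fact_gt0 ?ltr0n ?fact_gt0.
rewrite ler_wpM2r//; first by rewrite divr_ge0// ltW.
by apply: le_trans le_exp; rewrite ler_wpDl.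
Qed.

Lemma cvg_expRN_mixdens a k :
  expR (- N.+1%:R) ^+ a.+1 * mixdens k (expR (- N.+1%:R)) @[N --> \oo] --> (0 : R).
Proof.
have bnd0 : (k.+1%:R * harmonic N) @[N --> \oo] --> (0 : R).
  by rewrite -[X in _ --> X](mulr0 k.+1%:R); apply: cvgM; [exact: cvg_cst|exact: cvg_harmonic].
apply: squeeze_cvgr bnd0; last exact: cvg_cst.
apply: nearW => N.
have e1 : expR (- N.+1%:R) <= 1 :> R by rewrite -expR0 ler_expR oppr_le0.
rewrite mulr_ge0 ?exprn_ge0 ?expR_ge0 ?mixdens_ge0//=.
apply: le_trans (@expRN_mixdens_le k N.+1%:R _) => //.
by rewrite ler_wpM2r ?mixdens_ge0// exprS ler_piMr ?expR_ge0// exprn_ile1 ?expR_ge0.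
Qed.

Lemma cvg_logmoment_antideriv a m :
  logmoment_antideriv a m (expR (- N.+1%:R)) @[N --> \oo] --> (0 : R).
Proof.
elim: m => [|m IHm] /=; rewrite -[X in _ --> X](mul0r a.+1%:R^-1).
  apply: cvgM; last exact: cvg_cst.
  have := cvg_expRN_mixdens a 0; under eq_cvg do rewrite /mixdens expr0 fact0 divr1 mulr1.
  exact.
apply: cvgM; last exact: cvg_cst.
by rewrite -[X in _ --> X](addr0 0); apply: cvgD; [exact: cvg_expRN_mixdens|exact: IHm].
Qed.

Lemma logmoment_antideriv1 a m : logmoment_antideriv a m 1 = (a.+1%:R ^+ m.+1)^-1.
Proof.
elim: m => [|m IHm]; first by rewrite /= expr1n expr1 div1r.
by rewrite [LHS]/= mixdensS1 mulr0 add0r IHm [in RHS]exprSr invfM.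
Qed.

Lemma integral_Xn_mixdens a m :
  (\int[mu]_(p in `]0%R, 1%R[) (p ^+ a * mixdens m p)%:E
   = ((a.+1%:R ^+ m.+1)^-1)%:E)%E.
Proof.
have mf (D : set (measurableTypeR R)) : measurable D ->
    measurable_fun D (EFin \o (fun p => p ^+ a * mixdens m p)).
  move=> mD; apply/measurable_EFinP; apply: measurable_funTS.
  by apply: measurable_funM; [exact: measurable_funX|exact: measurable_mixdens].
rewrite integral_itv_bndo_bndc; last exact: mf.
(* Compact intervals exhausting []0, 1]], away from the singularity at [0]; with [N.+1] the left
   endpoint is below [1] already for [N = 0]. *)
pose I N : set R := `[expR (- N.+1%:R), 1]%classic.
have -> : (`]0%R, 1%R]%classic : set R) = \bigcup_N I N.
  apply/seteqP; split => [p/=|p [N _]]; rewrite /I /= !in_itv/=; last first.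
    by move=> /andP[ep ->]; rewrite (lt_le_trans _ ep) ?expR_gt0.
  move=> /andP[p0 p1]; exists (Num.truncn (- ln p)) => //=.
  rewrite in_itv/= p1 andbT -[leRHS]lnK// ler_expR lerNl.
  exact/ltW/truncnS_gt.
have cvgI := @ge0_nondecreasing_set_cvg_integral _ (measurableTypeR R) R I
  (EFin \o (fun p => p ^+ a * mixdens m p)) mu.
have IE N : (\int[mu]_(p in I N) (p ^+ a * mixdens m p)%:E =
    (logmoment_antideriv a m 1)%:E - (logmoment_antideriv a m (expR (- N.+1%:R)))%:E)%E.
  apply: integral_FTC2_pos.
  - exact: expR_gt0.
  - by rewrite -[ltRHS]expR0 ltr_expR oppr_lt0.
  - move=> x x0; apply: cvgM; last exact: continuous_mixdens.
    exact: exprn_continuous.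
  - by move=> x x0; exact: is_derive_logmoment_antideriv.
have {}cvgI : (\int[mu]_(p in I N) (p ^+ a * mixdens m p)%:E)%E @[N --> \oo] -->
    (\int[mu]_(p in \bigcup_N I N) (p ^+ a * mixdens m p)%:E)%E.
  apply: cvgI => [N M NM|i|i|i x].
  - apply/subsetPset; apply: subset_itvr; rewrite bnd_simp.
    by rewrite ler_expR lerN2 ler_nat ltnS.
  - exact: measurable_itv.
  - by apply: mf; exact: measurable_itv.
  - rewrite /I /= in_itv/= => /andP[ex x1].
    rewrite lee_fin mulr_ge0 ?mixdens_ge0// exprn_ge0//.
    exact: le_trans (expR_ge0 _) ex.
rewrite -(cvg_lim _ cvgI)//; apply/cvg_lim => //.
rewrite (_ : (fun _ => _) = EFin \o (fun N => logmoment_antideriv a m 1 -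
   logmoment_antideriv a m (expR (- N.+1%:R)))); last first.
  by apply/funext => N; rewrite /= IE EFinB.
apply: cvg_EFin; first exact: nearW.
rewrite -[X in _ --> X]subr0 -logmoment_antideriv1.
by apply: cvgB; [exact: cvg_cst|exact: cvg_logmoment_antideriv].
Qed.

Lemma integrable_Xn_mixdens a m :
  mu.-integrable `]0%R, 1%R[ (fun p => (p ^+ a * mixdens m p)%:E).
Proof.
apply/integrableP; split.
  apply/measurable_EFinP; apply: measurable_funTS.
  by apply: measurable_funM; [exact: measurable_funX|exact: measurable_mixdens].
rewrite [ltLHS](_ : _ = \int[mu]_(p in `]0%R, 1%R[) (p ^+ a * mixdens m p)%:E)%E; last first.
  apply: eq_integral => p; rewrite inE/= in_itv/= => /andP[p0 p1].
  by rewrite ger0_norm// mulr_ge0 ?exprn_ge0 ?mixdens_ge0// ltW.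
by rewrite integral_Xn_mixdens ltry.
Qed.

(** Linearity, by induction on the number of coefficients kept; integrals of polynomials against the
    density become algebra on [logmoment]. *)
Lemma integral_poly_mixdens m (P : {poly R}) :
  mu.-integrable `]0%R, 1%R[ (fun p => (P.[p] * mixdens m p)%:E) /\
  (\int[mu]_(p in `]0%R, 1%R[) (P.[p] * mixdens m p)%:E = (logmoment m.+1 P)%:E)%E.
Proof.
pose f n p := \sum_(i < n) P`_i * (p ^+ i * mixdens m p).
suff H n : mu.-integrable `]0%R, 1%R[ (EFin \o f n) /\
    (\int[mu]_(p in `]0%R, 1%R[) (f n p)%:E = (\sum_(i < n) P`_i / i.+1%:R ^+ m.+1)%:E)%E.
  have := H (size P).
  rewrite (_ : EFin \o f (size P) = (fun p => (P.[p] * mixdens m p)%:E)); last first.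
    apply/funext => p /=; rewrite horner_coef mulr_suml; congr (_%:E).
    by apply: eq_bigr => i _; rewrite mulrA.
  move=> [H1 H2]; split => //; rewrite /logmoment -H2.
  apply: eq_integral => p _; congr (_%:E).
  rewrite horner_coef mulr_suml; apply: eq_bigr => i _.
  exact: esym (mulrA _ _ _).
elim: n => [|n [IH1 IH2]].
  split; last by rewrite big_ord0 integral0_eq// => p _; rewrite /f big_ord0.
  rewrite (_ : _ \o _ = cst 0%E); first exact: integrable0.
  by apply/funext => p; rewrite /f /= big_ord0.
have intZ : mu.-integrable `]0%R, 1%R[ (fun p => (P`_n)%:E * (p ^+ n * mixdens m p)%:E)%E.
  by apply: integrableZl => //; exact: integrable_Xn_mixdens.
have fS : (EFin \o f n.+1) = (fun p => (f n p)%:E + (P`_n)%:E * (p ^+ n * mixdens m p)%:E)%E.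
  by apply/funext => p; rewrite /f /= big_ord_recr/= EFinD.
split; first by rewrite fS; apply: integrableD.
rewrite [LHS](_ : _ = \int[mu]_(p in `]0%R, 1%R[) (EFin \o f n.+1) p)%E// fS.
rewrite integralD//= IH2 integralZl//; last exact: integrable_Xn_mixdens.
by rewrite integral_Xn_mixdens big_ord_recr/= -EFinM -EFinD.
Qed.

End mixing_density.

(** * Bounds on the unconditional expectation by nested harmonic sums *)

Section EKn_bounds.
Variable R : realType.
Local Notation mu := (@lebesgue_measure R).

(** The weights [1 / (k+1)] of [harmonic_geomp] are those of the recursion [nested_harmonicS], which
    raises the degree by one. *)
Lemma logmoment_harmonic_geomp m n :
  logmoment m.+1 (harmonic_geomp R n) = nested_harmonic R m.+2 n.
Proof.
rewrite /harmonic_geomp logmoment_sum nested_harmonicS; apply: eq_bigr => k _.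
by rewrite logmomentZ mulrC.
Qed.

(** This bounds the gap between the integrated upper and lower bounds: each [1 - (1 - 'X)^(k+1)] has
    log-moment at most [1]. *)
Lemma logmoment_harmonic_geompMX m n :
  logmoment m.+1 (harmonic_geomp R n * 'X) <= harmonic_number R n.
Proof.
rewrite /harmonic_geomp mulr_suml logmoment_sum; apply: ler_sum => k _.
rewrite -scalerAl logmomentZ geompX ler_piMr// -scaleN1r logmomentD logmomentZ.
rewrite logmoment1 logmoment_onemX mulN1r gerBl divr_ge0//.
exact: nested_harmonic_ge0.
Qed.

Lemma EKn_bounds m n :
  ((nested_harmonic R m.+2 n - harmonic_number R n)%:E <= EKn R m n
    <= (nested_harmonic R m.+2 n)%:E)%E.
Proof.
have lo0 (p : R) : `]0, 1[%classic p ->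
    (0 <= ((harmonic_geomp R n * (1 - 'X)).[p] * mixdens m p)%:E)%E.
  rewrite /= in_itv/= => /andP[p0 p1].
  rewrite lee_fin; apply: mulr_ge0; last by rewrite mixdens_ge0 ?ltW.
  by rewrite hornerM !hornerE mulr_ge0 ?harmonic_geomp_ge0 ?subr_ge0 ?ltW.
have bnd : forall p : R, `]0, 1[%classic p ->
    (((harmonic_geomp R n * (1 - 'X)).[p] * mixdens m p)%:E
       <= EKn_cond n p * (mixdens m p)%:E
       <= ((harmonic_geomp R n).[p] * mixdens m p)%:E)%E.
  move=> p; rewrite /= in_itv/= => p01; have /andP[_ /ltW p1] := p01.
  have -> : (harmonic_geomp R n * (1 - 'X)).[p] = (harmonic_geomp R n).[p] * (1 - p).
    by rewrite hornerM !hornerE.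
  have /andP[lo up] := EKn_cond_bounds n p01.
  apply/andP; split; [rewrite [leLHS]EFinM|rewrite [leRHS]EFinM];
    by rewrite lee_wpmul2r ?lee_fin ?mixdens_ge0.
have [_ intW] := integral_poly_mixdens m (harmonic_geomp R n).
have [_ intW1] := integral_poly_mixdens m (harmonic_geomp R n * (1 - 'X)).
apply/andP; split; last first.
  rewrite -logmoment_harmonic_geomp -intW.
  apply: ge0_le_integral_restrict => [p pI|p pI|p].
  - by have /andP[lo _] := bnd p pI; exact: le_trans (lo0 p pI) lo.
  - by have /andP[lo up] := bnd p pI; exact: le_trans (le_trans (lo0 p pI) lo) up.
  - rewrite !patchE; case: ifPn => // /set_mem pI.
    by have /andP[] := bnd p pI.
apply: (@le_trans _ _ (logmoment m.+1 (harmonic_geomp R n * (1 - 'X)))%:E).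
  rewrite lee_fin mulrBr mulr1 -[- (_ * 'X)]scaleN1r logmomentD logmomentZ mulN1r.
  by rewrite logmoment_harmonic_geomp lerD2l lerN2 logmoment_harmonic_geompMX.
rewrite -intW1; apply: ge0_le_integral_restrict => [//|p pI|p].
- by have /andP[lo _] := bnd p pI; exact: le_trans (lo0 p pI) lo.
- rewrite !patchE; case: ifPn => // /set_mem pI.
  by have /andP[] := bnd p pI.
Qed.

End EKn_bounds.

(** * Bounds on [nu_arrow] *)

Section nu_bounds.
Variable R : realType.
Local Notation mu := (@lebesgue_measure R).
Implicit Types (p x : R).

Lemma ln_onem_bounds p : 0 < p < 1 -> p <= - ln (1 - p) <= p / (1 - p).
Proof.
move=> /andP[p0 p1]; have q0 : 0 < 1 - p by rewrite subr_gt0.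
apply/andP; split.
  by rewrite lerNr; apply: le_ln1Dx; rewrite ltrN2.
rewrite -lnV ?posrE//.
have -> : ln (1 - p)^-1 = ln (1 + p / (1 - p)).
  by congr ln; field; rewrite gt_eqF.
by apply: le_ln1Dx; rewrite (lt_le_trans (@ltrN10 R))// divr_ge0 ?ltW.
Qed.

Lemma count_ge_eq0 p x : 0 < p < 1 -> p < x -> count_ge p x = 0%E.
Proof.
move=> /andP[p0 p1] px; rewrite /count_ge (_ : [set _ | _] = set0) ?esum_set0//.
apply/seteqP; split => // j [_]; apply/negP; rewrite -ltNge; apply: le_lt_trans px.
by rewrite /geom_pmf ler_piMr ?(ltW p0)// exprn_ile1 ?subr_ge0 ?gerBl ?ltW.
Qed.

(** The probabilities decrease in [j], so those at least [x] form an initial segment, whose length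
    [N + 1] is the least exponent at which [p (1 - p)^i] drops below [x]. *)
Lemma count_ge_nat p x : 0 < p < 1 -> 0 < x -> x <= p ->
  exists N : nat, [/\ count_ge p x = N.+1%:R%:E,
    x <= p * (1 - p) ^+ N & p * (1 - p) ^+ N.+1 < x].
Proof.
move=> /andP[p0 p1] x0 xp.
have q0 : 0 <= 1 - p by rewrite subr_ge0 ltW.
have q1 : 1 - p <= 1 by rewrite gerBl ltW.
have mono i j : (i <= j)%N -> p * (1 - p) ^+ j <= p * (1 - p) ^+ i.
  by move=> ij; rewrite ler_wpM2l ?(ltW p0)// ler_wiXn2l.
have exN : exists N, p * (1 - p) ^+ N < x.
  have /cvgr_lt/(_ x x0) : (geometric p (1 - p)) @ \oo --> (0 : R).
    by apply: cvg_geometric; rewrite ger0_norm// gtrBl.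
  by case=> N _ /(_ N (leqnn N)) ?; exists N.
(* The least exponent is positive because [x <= p]; exponent [N.+1] belongs to the value [N.+2], the
   first one excluded. *)
case: (ex_minnP exN) => -[|N] ltx minN.
  by move: ltx; rewrite expr0 mulr1 ltNge xp.
have lex : x <= p * (1 - p) ^+ N.
  by rewrite leNgt; apply/negP => /minN; rewrite ltnn.
exists N; split => //; rewrite /count_ge.
have [s s_uniq [s_size sE]] : exists2 s : seq nat, uniq s &
    size s = N.+1 /\ forall j, (j \in s) = (0 < j <= N.+1)%N.
  exists (iota 1 N.+1); first exact: iota_uniq.
  by split=> [|j]; [rewrite size_iota|rewrite mem_iota add1n ltnS].
rewrite (_ : [set _ | _] = [set` s]); last first.
  apply/seteqP; split => [j [j0 xj]|j]/=; rewrite sE.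
    rewrite j0 leqNgt; apply/negP => Nj; move: xj; rewrite leNgt => /negP; apply.
    apply: le_lt_trans ltx; rewrite /geom_pmf; apply: mono.
    by case: j j0 Nj.
  move=> /andP[j0 jN]; split => //; apply: le_trans lex _; apply: mono.
  by case: j j0 jN.
rewrite esum_fset//; last exact: finite_seq.
rewrite -fsbig_seq// sumEFin; congr (_%:E).
by rewrite big_const_seq count_predT s_size iter_addr_0.
Qed.

(** With [a = - ln (1 - p)] and count [N + 1], taking logarithms gives
    [N a <= ln (p / x) < (N+1) a], and [p <= a <= p / (1 - p)]. *)
Lemma count_ge_bounds p x : 0 < p < 1 -> 0 < x -> x <= p ->
  (((ln p - ln x) * (1 - p) / p)%:E <= count_ge p x
    <= (1 + (ln p - ln x) / p)%:E)%E.
Proof.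
move=> p01 x0 xp; have [p0 p1] : 0 < p /\ p < 1 by case/andP: p01.
have [N [-> lex ltx]] := count_ge_nat p01 x0 xp.
have q0 : 0 < 1 - p by rewrite subr_gt0.
have qX j : 0 < p * (1 - p) ^+ j by rewrite mulr_gt0 ?exprn_gt0.
have lnE j : ln (p * (1 - p) ^+ j) = ln p - j%:R * - ln (1 - p).
  by rewrite lnM ?posrE ?exprn_gt0// lnXn// mulrN opprK mulr_natl.
move: lex ltx; rewrite -ler_ln ?posrE// -ltr_ln ?posrE// !lnE => lex ltx.
have /andP[lo up] := ln_onem_bounds p01.
have N1 : 0 <= N.+1%:R :> R by [].
have N0 : 0 <= N%:R :> R by [].
have loN := ler_wpM2l N0 lo; have upN := ler_wpM2l N1 up.
rewrite !lee_fin; apply/andP; split.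
  rewrite ler_pdivrMr// -ler_pdivlMr// -mulrA; lra.
rewrite -natr1 addrC lerD2l ler_pdivlMr//; lra.
Qed.

Lemma integral_log_mixdens m x : 0 < x < 1 ->
  (\int[mu]_(p in `[x, 1%R]) ((ln p - ln x) / p * mixdens m p)%:E
   = ((- ln x) ^+ m.+2 / (m.+2)`!%:R)%:E)%E.
Proof.
move=> /andP[x0 x1].
(* An antiderivative, because [- ln p * mixdens m p = (m+1) * mixdens m.+1 p]; it vanishes at
   [1]. *)
pose F (p : R) := ln x * mixdens m.+1 p + m.+1%:R * mixdens m.+2 p.
transitivity ((F 1)%:E - (F x)%:E)%E; last first.
  rewrite /F !mixdensS1 !mulr0 addr0 sub0e -EFinN; congr (_%:E).
  rewrite /mixdens (factS m.+1) natrM invfM (exprS _ m.+1).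
  have f0 : (m.+1)`!%:R != 0 :> R by rewrite pnatr_eq0 -lt0n fact_gt0.
  have m0 : m.+2%:R != 0 :> R by rewrite pnatr_eq0.
  have mE : m.+2%:R = m.+1%:R + 1 :> R by rewrite natr1.
  rewrite mE in m0 *; move: (m.+1%:R : R) m0 ((m.+1)`!%:R : R) f0 => c c0 f f0.
  by field; rewrite c0 f0.
apply: integral_FTC2_pos => // p p0.
- apply: cvgM; last exact: continuous_mixdens.
  apply: cvgM; last by apply: cvgV; [rewrite gt_eqF|exact: cvg_id].
  by apply: cvgB; [exact: continuous_ln|exact: cvg_cst].
- have d1 := is_deriveZ (ln x) (is_derive_mixdens m p0).
  have d2 := is_deriveZ m.+1%:R (is_derive_mixdens m.+1 p0).
  have := is_deriveD d1 d2.
  rewrite (_ : _ + _ = F)// => dF; apply: is_derive_eq; rewrite /GRing.scale/=.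
  rewrite 2!mulrN [m.+1%:R * _]mulrA -mulr_ln_mixdens.
  by field; rewrite gt_eqF.
Qed.

Lemma nu_arrow_bounds m x : 0 < x < 1 ->
  ((((- ln x) ^+ m.+2 / (m.+2)`!%:R) - (- ln x))%:E <= nu_arrow m x
    <= ((- ln x) ^+ m.+2 / (m.+2)`!%:R + 1)%:E)%E.
Proof.
move=> x01; have [x0 x1] : 0 < x /\ x < 1 by case/andP: x01.
have pI (p : R) : `[x, 1[%classic p -> [/\ 0 < p < 1, x <= p & ln x <= ln p].
  rewrite /= in_itv/= => /andP[xp p1]; have p0 := lt_le_trans x0 xp.
  by rewrite p0 p1 xp ler_ln ?posrE.
have c0 p : (0 <= count_ge p x)%E by apply: esum_ge0.
have f0 (p : R) : `]0, 1[%classic p -> (0 <= count_ge p x * (mixdens m p)%:E)%E.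
  rewrite /= in_itv/= => /andP[_ p1].
  by rewrite mule_ge0// lee_fin mixdens_ge0// ltW.
have mpos (f : R -> R) : (forall p : R, 0 < p -> {for p, continuous f}) ->
    measurable_fun (`[x, 1[%classic : set (measurableTypeR R)) (EFin \o f).
  move=> cf; apply/measurable_EFinP; apply: subspace_continuous_measurable_fun => //.
  apply: continuous_in_subspaceT => p /set_mem/pI[/andP[p0 _] _ _].
  exact: cf.
have cln p : 0 < p -> {for p, continuous (fun p => ln p - ln x)}.
  by move=> p0; apply: cvgB; [exact: continuous_ln|exact: cvg_cst].
have cV p : 0 < p -> {for p, continuous (@GRing.inv R)}.
  by move=> p0; apply: cvgV; [rewrite gt_eqF|exact: cvg_id].
have cmix p : 0 < p -> {for p, continuous (@mixdens R m)}.
  exact: continuous_mixdens.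
have main : (\int[mu]_(p in `[x, 1%R[) ((ln p - ln x) / p * mixdens m p)%:E
   = ((- ln x) ^+ m.+2 / (m.+2)`!%:R)%:E)%E.
  rewrite -integral_log_mixdens// integral_itv_bndo_bndc//.
  apply: (mpos (fun p => (ln p - ln x) / p * mixdens m p)) => p p0.
  by apply: cvgM; [apply: cvgM; [exact: cln|exact: cV]|exact: cmix].
(* The density has total mass [logmoment m.+1 1 = 1], so a factor bounded by [c] contributes at most
   [c]. *)
have int_le (c : R) (f : R -> R) :
    (forall p : R, `[x, 1[%classic p -> 0 <= f p <= c) ->
    (\int[mu]_(p in `[x, 1%R[) (f p * mixdens m p)%:E <= c%:E)%E.
  move=> fc; have [_] := integral_poly_mixdens m (c%:P).
  rewrite -[X in logmoment _ X]mulr1 mul_polyC logmomentZ logmoment1 mulr1 => <-.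
  have c_ge0 : 0 <= c.
    have /fc/andP[f0' fc'] : `[x, 1[%classic x by rewrite /= in_itv/= lexx.
    exact: le_trans f0' fc'.
  apply: ge0_le_integral_restrict => [p|p|p].
  - move=> Ip; have [/andP[_ p1] _ _] := pI p Ip; have /andP[fp _] := fc p Ip.
    by rewrite lee_fin mulr_ge0// mixdens_ge0// ltW.
  - rewrite /= in_itv/= => /andP[_ p1].
    by rewrite lee_fin hornerC mulr_ge0// mixdens_ge0// ltW.
  - rewrite !patchE; case: ifPn => [/set_mem Ip|_].
      have [/andP[p0 p1] _ _] := pI p Ip; have /andP[_ fp] := fc p Ip.
      rewrite mem_set/= ?in_itv/= ?p0//.
      by rewrite lee_fin hornerC ler_wpM2r// mixdens_ge0// ltW.
    case: ifPn => // /set_mem; rewrite /= in_itv/= => /andP[_ p1].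
    by rewrite lee_fin hornerC mulr_ge0// mixdens_ge0// ltW.
apply/andP; split.
  rewrite EFinB leeBlDr// -main.
  pose f p := (ln p - ln x) * (1 - p) / p * mixdens m p.
  pose g p := (ln p - ln x) * mixdens m p.
  have f_ge0 (p : R) : `[x, 1[%classic p -> (0 <= (EFin \o f) p)%E.
    move=> /pI[/andP[p0 p1] _ lnxp]; rewrite lee_fin /f mulr_ge0 ?mixdens_ge0 ?(ltW p1)//.
    by rewrite divr_ge0 ?(ltW p0)// mulr_ge0 ?subr_ge0// ltW.
  have g_ge0 (p : R) : `[x, 1[%classic p -> (0 <= (EFin \o g) p)%E.
    move=> /pI[/andP[p0 p1] _ lnxp]; rewrite lee_fin /g mulr_ge0 ?subr_ge0//.
    by rewrite mixdens_ge0 ?ltW.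
  (* Splits [1 / p = (1 - p) / p + 1]: the first part lies below the count, the second contributes
     at most [- ln x] because [ln p <= 0]. *)
  have -> : (\int[mu]_(p in `[x, 1%R[) ((ln p - ln x) / p * mixdens m p)%:E =
      \int[mu]_(p in `[x, 1%R[) ((EFin \o f) p + (EFin \o g) p))%E.
    apply: eq_integral => p /set_mem/pI[/andP[p0 p1] _ _]; rewrite /= -EFinD /f /g.
    by congr (_%:E); field; rewrite gt_eqF.
  rewrite ge0_integralD//; last 2 first.
  - apply: mpos => p p0; apply: cvgM; last exact: cmix.
    apply: cvgM; last exact: cV.
    apply: cvgM; first exact: cln.
    by apply: cvgB; [exact: cvg_cst|exact: cvg_id].
  - by apply: mpos => p p0; apply: cvgM; [exact: cln|exact: cmix].
  apply: leeD; last first.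
    apply: int_le => p /pI[/andP[p0 p1] _ lnxp].
    by rewrite subr_ge0 lnxp/= lerBlDr addNr ln_le0 ?ltW.
  apply: ge0_le_integral_restrict => // p; rewrite !patchE.
  case: ifPn => [/set_mem Ip|_].
    have [p01 xp _] := pI p Ip; have /andP[p0 p1] := p01.
    rewrite mem_set/= ?in_itv//= /f EFinM.
    have /andP[lo _] := count_ge_bounds p01 x0 xp.
    by rewrite lee_wpmul2r// lee_fin mixdens_ge0// ltW.
  by case: ifPn => // /set_mem/f0.
pose f p := 1 * mixdens m p.
pose g p := (ln p - ln x) / p * mixdens m p.
have f_ge0 (p : R) : `[x, 1[%classic p -> (0 <= (EFin \o f) p)%E.
  by move=> /pI[/andP[p0 p1] _ _]; rewrite lee_fin /f mulr_ge0 ?mixdens_ge0 ?(ltW p1).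
have g_ge0 (p : R) : `[x, 1[%classic p -> (0 <= (EFin \o g) p)%E.
  move=> /pI[/andP[p0 p1] _ lnxp]; rewrite lee_fin /g mulr_ge0 ?mixdens_ge0 ?(ltW p1)//.
  by rewrite divr_ge0 ?(ltW p0)// subr_ge0.
(* Only [[x, 1[] matters: for [p < x] every probability is below [x] and the count is zero. *)
apply: (@le_trans _ _ (\int[mu]_(p in `[x, 1%R[) ((EFin \o g) p + (EFin \o f) p))%E).
  apply: ge0_le_integral_restrict => // [p Ip|p].
    by rewrite adde_ge0 ?f_ge0 ?g_ge0.
  rewrite !patchE; case: ifPn => [/set_mem|_].
    rewrite /= in_itv/= => p01; have /andP[p0 p1] := p01.
    have [xp|px] := leP x p; last first.
      rewrite count_ge_eq0// mul0e; case: ifPn => // /set_mem Ip.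
      by apply: adde_ge0; [exact: g_ge0|exact: f_ge0].
    rewrite mem_set/= ?in_itv/= ?xp//.
    have /andP[_ up] := count_ge_bounds p01 x0 xp.
    have -> : ((g p)%:E + (f p)%:E = (1 + (ln p - ln x) / p)%:E * (mixdens m p)%:E)%E.
      by rewrite -EFinD -EFinM /f /g; congr (_%:E); ring.
    by rewrite lee_wpmul2r// lee_fin mixdens_ge0// ltW.
  case: ifPn => // /set_mem Ip.
  by apply: adde_ge0; [exact: g_ge0|exact: f_ge0].
rewrite ge0_integralD//; last 2 first.
- by apply: mpos => p p0; apply: cvgM; [apply: cvgM; [exact: cln|exact: cV]|exact: cmix].
- by apply: mpos => p p0; apply: cvgM; [exact: cvg_cst|exact: cmix].
rewrite EFinD -main leeD2l//; apply: int_le => p _.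
by rewrite ler01 lexx.
Qed.

End nu_bounds.

(** * Harmonic numbers, logarithms and the Euler constant *)

Section euler_gamma.
Variable R : realType.
Implicit Types n : nat.

Lemma ln_succ_bounds n :
  n.+2%:R^-1 <= ln (n.+2%:R : R) - ln n.+1%:R <= n.+1%:R^-1.
Proof.
have n1 : 0 < n.+1%:R :> R by [].
have n2 : 0 < n.+2%:R :> R by [].
have nE : n.+2%:R = n.+1%:R + 1 :> R by rewrite natr1.
apply/andP; split.
  rewrite -opprB lerNr -ln_div ?posrE//.
  have -> : n.+1%:R / n.+2%:R = 1 + - n.+2%:R^-1 :> R.
    by rewrite nE in n2 *; field; rewrite gt_eqF.
  by apply: le_ln1Dx; rewrite ltrN2 invf_lt1// ltr1n.
rewrite -ln_div ?posrE//.
have -> : n.+2%:R / n.+1%:R = 1 + n.+1%:R^-1 :> R.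
  by rewrite nE; field; rewrite gt_eqF.
by apply: le_ln1Dx; rewrite (lt_le_trans (@ltrN10 R)).
Qed.

Lemma ln_le_harmonic_number n : ln (n.+1%:R : R) <= harmonic_number R n.
Proof.
elim: n => [|n IHn]; first by rewrite ln1 harmonic_number_ge0.
have /andP[_ up] := ln_succ_bounds n.
by rewrite harmonic_numberS -lerBlDl (le_trans _ up)// lerD2l lerN2.
Qed.

Lemma cvg_euler_gamma :
  harmonic_number R n - ln (n%:R : R) @[n --> \oo] --> euler_gamma R.
Proof.
rewrite /euler_gamma.
rewrite (_ : (fun n => \sum_(1 <= k < n.+1) _ - _) =
    (fun n => harmonic_number R n - ln (n%:R : R))); last first.
  apply/funext => n; rewrite big_add1/= big_mkord; congr (_ - _).
set u := fun n => _; suff : cvgn u by [].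
(* The sequence decreases only from index [1] on: the default [ln 0 = 0] gives [u 0 = 0 < u 1]. *)
suff /cvg_ex[/= l ul] : cvgn (fun n => u n.+1).
  by apply/cvg_ex; exists l; rewrite -cvg_shiftS.
apply: nonincreasing_is_cvgn.
  apply/nonincreasing_seqP => n /=; rewrite /u.
  have /andP[lo _] := ln_succ_bounds n.
  by rewrite (harmonic_numberS R n.+1) -addrA lerD2l lerBlDr addrC.
exists 0 => _ [n _ <-]; rewrite /u subr_ge0.
apply: le_trans (ln_le_harmonic_number n) _; exact: le_harmonic_number.
Qed.

Lemma cvg_lnV : (ln (n%:R : R))^-1 @[n --> \oo] --> (0 : R).
Proof.
apply/gtr0_cvgV0.
  near=> n; rewrite ln_gt0// ltr1n; near: n; exact: nbhs_infty_gt.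
apply/cvgryPge => A; near=> n.
have eA : expR A <= n%:R by near: n; exact: nbhs_infty_ger.
by rewrite -ler_expR lnK// posrE (lt_le_trans (expR_gt0 A)).
Unshelve. all: by end_near. Qed.

Lemma cvg_harmonic_number_ln :
  harmonic_number R n / ln (n%:R : R) @[n --> \oo] --> (1 : R).
Proof.
have lim1 : (harmonic_number R n - ln (n%:R : R)) * (ln (n%:R : R))^-1 + 1 @[n --> \oo]
    --> euler_gamma R * 0 + 1.
  by apply: cvgD; [apply: cvgM; [exact: cvg_euler_gamma|exact: cvg_lnV]|exact: cvg_cst].
rewrite mulr0 add0r in lim1; apply: cvg_trans lim1; apply: near_eq_cvg.
near=> n; have ln0 : ln (n%:R : R) != 0.
  rewrite gt_eqF// ln_gt0// ltr1n; near: n; exact: nbhs_infty_gt.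
by rewrite mulrBl divff// subrK.
Unshelve. all: by end_near. Qed.

Lemma cvg_exprn r (a : nat -> R) (l : R) : a @ \oo --> l ->
  a n ^+ r @[n --> \oo] --> l ^+ r.
Proof.
move=> al; elim: r => [|r IHr]; first by under eq_cvg do rewrite expr0; exact: cvg_cst.
by under eq_cvg do rewrite exprS; rewrite exprS; apply: cvgM.
Qed.

Lemma cvg_geometric_sum r (a : nat -> R) : a @ \oo --> (1 : R) ->
  \sum_(i < r) a n ^+ i @[n --> \oo] --> (r%:R : R).
Proof.
move=> a1; elim: r => [|r IHr].
  by under eq_cvg do rewrite big_ord0; exact: cvg_cst.
under eq_cvg do rewrite big_ord_recr/=.
rewrite -natr1; apply: cvgD => //.
by rewrite -(expr1n R r); exact: cvg_exprn.
Qed.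

(** Here [m] is one less than in the theorem. After division by [L^(m+2)], with [L = ln n] and
    [a = H / L] tending to [1], the left side is the null sequence [E], since [H^(m+3) - L^(m+3)] is
    [L^(m+2) (H - L)] times a geometric sum in [a] tending to [m+3]. *)
Lemma harmonic_number_pow_asymp m C (eps : R) : 0 < eps -> exists N, forall n, (N <= n)%N ->
  [/\ 0 < ln (n%:R : R) &
  `|harmonic_number R n ^+ m.+3 / (m.+3)`!%:R - (ln (n%:R : R) ^+ m.+3 / (m.+3)`!%:R
      + euler_gamma R * ln (n%:R : R) ^+ m.+2 / (m.+2)`!%:R)|
  + C * harmonic_number R n ^+ m.+1 + harmonic_number R n <= eps * ln (n%:R : R) ^+ m.+2].
Proof.
move=> eps0.
pose L n := ln (n%:R : R); pose H n := harmonic_number R n; pose a n := H n / L n.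
have a1 : a @ \oo --> (1 : R) by exact: cvg_harmonic_number_ln.
have b0 : (L n)^-1 @[n --> \oo] --> (0 : R) by exact: cvg_lnV.
have e0 : H n - L n @[n --> \oo] --> euler_gamma R by exact: cvg_euler_gamma.
pose E n := `|(H n - L n) * (\sum_(i < m.+3) a n ^+ i) / (m.+3)`!%:R
   - euler_gamma R / (m.+2)`!%:R| + C * a n ^+ m.+1 * (L n)^-1 + a n * (L n)^-1 ^+ m.+1.
have E0 : E @ \oo --> (0 : R).
  (* The limits cancel because [(m+3) / (m+3)! = 1 / (m+2)!]. *)
  have -> : 0 = `|euler_gamma R * m.+3%:R / (m.+3)`!%:R
    - euler_gamma R / (m.+2)`!%:R| + C * 1 ^+ m.+1 * 0 + 1 * 0 ^+ m.+1 :> R.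
    rewrite mulr0 expr0n mulr0 !addr0 factS natrM invfM mulrA mulfK ?pnatr_eq0//.
    by rewrite subrr normr0.
  apply: cvgD; [apply: cvgD|].
  - apply: cvg_norm; apply: cvgB; last exact: cvg_cst.
    apply: cvgM; last exact: cvg_cst.
    by apply: cvgM => //; exact: cvg_geometric_sum.
  - by apply: cvgM => //; apply: cvgM; [exact: cvg_cst|exact: cvg_exprn].
  - by apply: cvgM => //; exact: cvg_exprn.
have /cvgr_lt/(_ eps eps0)[N0 _ EN] := E0.
exists (maxn N0 2) => n; rewrite geq_max => /andP[N0n n2].
have L0 : 0 < L n by rewrite ln_gt0// ltr1n.
split => //; have := EN n N0n; move=> /ltW En.
apply: le_trans (ler_wpM2r (exprn_ge0 m.+2 (ltW L0)) En).
rewrite le_eqVlt; apply/orP; left; apply/eqP.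
rewrite /E -/(L n) -/(H n) 2!mulrDl; congr (_ + _ + _).
- rewrite -[X in _ = _ * X]ger0_norm ?exprn_ge0 ?(ltW L0)// -normrM; congr (`|_|).
  have -> : H n ^+ m.+3 = L n ^+ m.+3 + L n ^+ m.+2 * ((H n - L n) * \sum_(i < m.+3) a n ^+ i).
    have aE : H n - L n = L n * (a n - 1).
      by rewrite mulrBr mulr1 /a mulrCA divff ?gt_eqF// mulr1.
    have -> : (H n - L n) * \sum_(i < m.+3) a n ^+ i = L n * (a n ^+ m.+3 - 1).
      by rewrite subrX1 mulrA -aE.
    rewrite mulrA -exprSr mulrBr mulr1 addrC subrK.
    by rewrite /a exprMn exprVn mulrCA divff ?mulr1// expf_neq0// gt_eqF.
  by ring.
- rewrite /a expr_div_n (exprS (L n) m.+1).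
  have := expf_neq0 m.+1 (lt0r_neq0 L0); move: (L n ^+ m.+1) => z z0.
  by field; rewrite z0 lt0r_neq0.
- rewrite /a exprVn (exprS (L n) m.+1).
  have := expf_neq0 m.+1 (lt0r_neq0 L0); move: (L n ^+ m.+1) => z z0.
  by field; rewrite z0 lt0r_neq0.
Qed.

End euler_gamma.

(** * Conclusion: both asymptotic expansions *)

Lemma ereal_between_fin (R : realType) (x : \bar R) (a b : R) :
  (a%:E <= x <= b%:E)%E -> exists2 r, x = r%:E & a <= r <= b.
Proof.
case: x => [r|/andP[_]|/andP[]]; last 2 first.
- by rewrite leye_eq.
- by rewrite leeNy_eq.
by rewrite !lee_fin => abr; exists r.
Qed.

Theorem theorem2 (R : realType) (m : nat) (hm : (1 <= m)%N) :
  (exists C : R, exists delta : R, 0 < delta /\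
     forall x : R, 0 < x -> x < delta -> x < 1 ->
       (`| nu_arrow m x - ((ln (x^-1)) ^+ (m.+2) / (m.+2)`!%:R)%:E |
          <= (C * `| ln x | ^+ m)%:E)%E)
  /\
  (forall eps : R, 0 < eps -> exists N : nat, forall n : nat, (N <= n)%N ->
     (`| EKn R m n - ((ln (n%:R : R)) ^+ (m.+2) / (m.+2)`!%:R
                      + euler_gamma R * (ln (n%:R : R)) ^+ (m.+1) / (m.+1)`!%:R)%:E |
        <= (eps * (ln (n%:R : R)) ^+ (m.+1))%:E)%E).
Proof.
split.
  (* Below [expR (-1)] one has [L = - ln x >= 1], so for [m >= 1] the errors [L] and [1] are both at
     most [L^m]. *)
  exists 2, (expR (-1)); split; first exact: expR_gt0.
  move=> x x0 xe x1.
  have L1 : 1 <= - ln x.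
    by rewrite lerNr -ler_expR lnK ?posrE// ltW.
  have [|r -> ] := ereal_between_fin (@nu_arrow_bounds R m x _); first by rewrite x0.
  rewrite lnV ?posrE// ler0_norm; last by rewrite -oppr_ge0 (le_trans _ L1).
  rewrite -EFinB lee_fin.
  set M := _ / _; move: (- ln x) L1 => L L1 /andP[lo up].
  have Lm : L <= L ^+ m.
    by case: m hm {lo up M} => // m _; rewrite exprS ler_peMr ?exprn_ege1// (le_trans _ L1).
  by rewrite ler_norml; apply/andP; split; lra.
move=> eps eps0.
have [C C0 TC] := nested_harmonic_asymp R m.
case: m hm TC => // m _ TC.
have [N HN] := harmonic_number_pow_asymp m C eps0.
exists N => n /HN[L0 le_eps]; have [r -> /andP[lo up]] := ereal_between_fin (EKn_bounds R m.+1 n).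
rewrite -EFinB lee_fin; apply: le_trans le_eps.
have := TC n; have := harmonic_number_ge0 R n.
move: (nested_harmonic _ _ _) lo up => T lo up.
set A := harmonic_number R n ^+ m.+3 / _; set B := (X in r - X) => H0 TA.
(* The differences replace [H] by [ln n], the nested sum by a power of [H], and the expectation by
   the nested sum; they match the three terms bounded in [le_eps]. *)
rewrite (_ : r - B = (A - B) + (T - A) + (r - T)); last by ring.
apply: le_trans (ler_normD _ _) (lerD _ _); last first.
  by rewrite ler_norml; apply/andP; split; lra.
by apply: le_trans (ler_normD _ _) (lerD _ _).
Qed.
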